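(* Let $K$ be a commutative unital ring and $S$ an inverse monoid. Let $P_0=KS$, $P_n=\bigoplus_{s_1,\dots,s_n\in S}KS\,\mathbf r(s_1\cdots s_n)$ for $n>0$, and let $\partial_0:P_0\to KE(S)$ and $\partial_n:P_n\to P_{n-1}$ $(n>0)$ be the morphisms of left $KS$-modules defined by $$\partial_0(s(\ ))=\mathbf r(s),\ s\in S,\qquad \partial_1(t(s))=t(s(\ )-(\ )),\ t(s)\in P_1,$$ $$\partial_n(t(s_1,\dots,s_n))=t\Big(s_1(s_2,\dots,s_n)+\sum_{i=1}^{n-1}(-1)^i(s_1,\dots,s_is_{i+1},\dots,s_n)+(-1)^n(s_1,\dots,s_{n-1})\Big)$$ for $n>1$, $t(s_1,\dots,s_n)\in P_n$. Then the sequence $$\cdots\xrightarrow{\partial_2}P_1\xrightarrow{\partial_1}P_0\xrightarrow{\partial_0}KE(S)\to 0$$ is a projective resolution of $KE(S)$ in the category of left $KS$-modules.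
   Context: $KS$ is the semigroup algebra of $S$ over $K$, $E(S)$ is the set (commutative submonoid) of idempotents of $S$, and $KE(S)$ is its semigroup algebra, regarded as a left $KS$-module by $s\cdot e=ses^{-1}$ for $s\in S$, $e\in E(S)$. For $s\in S$, $\mathbf d(s)=s^{-1}s$ and $\mathbf r(s)=ss^{-1}$. On $E(S)$, $e\le f$ means $e=ef$. Notation for $P_n$. For $n>0$, the tuple $(s_1,\dots,s_n)$ denotes the generator $\mathbf r(s_1\cdots s_n)$ of the summand $KS\,\mathbf r(s_1\cdots s_n)$ of $P_n$ indexed by $(s_1,\dots,s_n)$. For arbitrary $t\in S$, $t(s_1,\dots,s_n)$ means $t\,\mathbf r(s_1\cdots s_n)(s_1,\dots,s_n)$. $P_n$ is a free $K$-module with basis $\{t(s_1,\dots,s_n)\mid t,s_1,\dots,s_n\in S,\ \mathbf d(t)\le\mathbf r(s_1\cdots s_n)\}$. For $n=0$, $(\ )$ denotes the generator $1_S$ of $P_0=KS$, so $P_0$ is $K$-free on $\{t(\ )\mid t\in S\}$. *)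

(* Defs.v *)
From HB Require Import structures.
From mathcomp Require Import all_boot ssralg finmap.
From mathcomp.multinomials Require Import monalg.

Set Implicit Arguments.
Unset Strict Implicit.
Unset Printing Implicit Defensive.

Import GRing.Theory.
Local Open Scope ring_scope.

(* Here [^-1] is the inverse of an inverse semigroup, not a group inverse:
   [s * s^-1] need not be [1]. The axioms [invgK] and [invgM] inherited from
   [starMonoidType] follow from the others, see [isInverseMonoid] below. *)
HB.mixin Record StarMonoid_isInverseMonoid S of StarMonoid S := {
  mulgVg : forall s : S, (s * s^-1 * s = s)%g;
  mulVgV : forall s : S, (s^-1 * s * s^-1 = s^-1)%g;
  invg_unique : forall s t : S,
    (s * t * s = s)%g -> (t * s * t = t)%g -> t = (s^-1)%g
}.

#[short(type="inverseMonoidType")]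
HB.structure Definition InverseMonoid :=
  {S of StarMonoid_isInverseMonoid S & StarMonoid S}.

Bind Scope group_scope with InverseMonoid.sort.

HB.factory Record isInverseMonoid S of Monoid S := {
  inv : S -> S;
  mulgVg : forall s : S, (s * inv s * s = s)%g;
  mulVgV : forall s : S, (inv s * s * inv s = inv s)%g;
  invg_unique : forall s t : S,
    (s * t * s = s)%g -> (t * s * t = t)%g -> t = inv s
}.

HB.builders Context S of isInverseMonoid S.

Local Open Scope group_scope.
Implicit Types s t e f : S.

Fact invK : involutive inv.
Proof. by move=> s; apply/esym/invg_unique; rewrite ?mulgVg ?mulVgV. Qed.

Fact inv_idem e : e * e = e -> inv e = e.
Proof. by move=> ee; apply/esym/invg_unique; rewrite !ee. Qed.

Fact mul_idem e f : e * e = e -> f * f = f -> e * f * (e * f) = e * f.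
Proof.
move=> ee ff; set x := inv (e * f).
have xE : f * x * e = x.
  apply: invg_unique.
    by rewrite !mulgA -(mulgA e f f) ff -(mulgA _ e e) ee -(mulgA _ e f) mulgVg.
  rewrite !mulgA -(mulgA _ e e) ee -(mulgA _ f f) ff.
  by rewrite -(mulgA (f * x)) -(mulgA f x (e * f)) -(mulgA f) mulVgV.
have xx : x * x = x.
  rewrite -{1}xE -{2}xE !mulgA -(mulgA (f * x) e f) -(mulgA f x (e * f)).
  by rewrite -(mulgA f _ x) mulVgV xE.
by have := inv_idem xx; rewrite invK => ->.
Qed.

Fact idem_comm e f : e * e = e -> f * f = f -> e * f = f * e.
Proof.
move=> ee ff; rewrite -(inv_idem (mul_idem ee ff)); apply/esym/invg_unique.
  have := mul_idem ee ff.
  by rewrite !mulgA -(mulgA e f f) ff -(mulgA _ e e) ee.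
have := mul_idem ff ee.
by rewrite !mulgA -(mulgA f e e) ee -(mulgA _ f f) ff.
Qed.

Fact invM : {morph inv : s t / s * t >-> t * s}.
Proof.
move=> s t; have tsC : t * inv t * (inv s * s) = inv s * s * (t * inv t).
  by apply: idem_comm; rewrite !mulgA ?mulgVg ?mulVgV.
apply/esym/invg_unique.
  have -> : s * t * (inv t * inv s) * (s * t)
            = s * (t * inv t * (inv s * s)) * t by rewrite !mulgA.
  by rewrite tsC !mulgA mulgVg -!mulgA (mulgA t) mulgVg.
have -> : inv t * inv s * (s * t) * (inv t * inv s)
          = inv t * (inv s * s * (t * inv t)) * inv s by rewrite !mulgA.
by rewrite -tsC !mulgA mulVgV -!mulgA (mulgA (inv s)) mulVgV.
Qed.

HB.instance Definition _ := hasInv.Build S inv.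
HB.instance Definition _ := Monoid_isStarMonoid.Build S invK invM.
HB.instance Definition _ :=
  StarMonoid_isInverseMonoid.Build S mulgVg mulVgV invg_unique.

HB.end.

Section InverseMonoidTheory.
Variable S : inverseMonoidType.
Implicit Types s t e f : S.
Local Open Scope group_scope.

Definition dom s := s^-1 * s.
Definition rng s := s * s^-1.

Definition is_idem : pred S := [pred e : S | e * e == e].

(* The natural order on idempotents. *)
Definition idem_le e f := e == e * f.

Lemma dom_idem s : dom s \in is_idem.
Proof. by rewrite inE /dom mulgA mulVgV. Qed.

Lemma rng_idem s : rng s \in is_idem.
Proof. by rewrite inE /rng mulgA mulgVg. Qed.

Lemma idemV e : e \in is_idem -> e^-1 = e.
Proof. by move/eqP=> ee; apply/esym/invg_unique; rewrite !ee. Qed.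

Lemma idemM e f :
  e \in is_idem -> f \in is_idem -> e * f \in is_idem.
Proof.
move=> ie jf; apply/eqP; rewrite -[RHS]mulgVg invgM (idemV ie) (idemV jf).
by rewrite !mulgA -(mulgA e f f) (eqP jf) -(mulgA _ e e) (eqP ie).
Qed.

Lemma idemC e f :
  e \in is_idem -> f \in is_idem -> e * f = f * e.
Proof.
move=> ie jf; rewrite -(idemV (idemM ie jf)) invgM.
by rewrite (idemV ie) (idemV jf).
Qed.

Lemma conj_idem s e : e \in is_idem -> s * e * s^-1 \in is_idem.
Proof.
move=> ie; have /eqP ee := ie; apply/eqP.
have -> : s * e * s^-1 * (s * e * s^-1) = s * (e * dom s) * e * s^-1.
  by rewrite /dom !mulgA.
by rewrite (idemC ie (dom_idem s)) /dom !mulgA mulgVg -(mulgA s e e) ee.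
Qed.

Lemma one_idem : (1 : S) \in is_idem.
Proof. by rewrite inE mulg1. Qed.

Lemma rng1 : rng 1 = 1.
Proof. by rewrite /rng (idemV one_idem) mulg1. Qed.

Lemma mul_rng s : rng s * s = s.
Proof. exact: mulgVg. Qed.

End InverseMonoidTheory.

Section Idempotents.
Variable S : inverseMonoidType.

Record idem := Idem { idem_val : S; idemP : idem_val \in @is_idem S }.

HB.instance Definition _ := [isSub for idem_val].
HB.instance Definition _ := [Choice of idem by <:].

Definition idem_one := Idem (one_idem S).
Definition idem_mul (e f : idem) := Idem (idemM (idemP e) (idemP f)).

Fact idem_mulA : associative idem_mul.
Proof. by move=> e f g; apply: val_inj; rewrite /= mulgA. Qed.
Fact idem_mul1g : left_id idem_one idem_mul.
Proof. by move=> e; apply: val_inj; rewrite /= mul1g. Qed.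
Fact idem_mulg1 : right_id idem_one idem_mul.
Proof. by move=> e; apply: val_inj; rewrite /= mulg1. Qed.

HB.instance Definition _ :=
  isMonoid.Build idem idem_mulA idem_mul1g idem_mulg1.

Definition idem_conj (s : S) (e : idem) : idem := Idem (conj_idem s (idemP e)).
Definition idem_rng (s : S) : idem := Idem (rng_idem s).

End Idempotents.

Section HomologicalAlgebra.
Variable R : pzRingType.

Definition surj (T U : Type) (f : T -> U) := forall y, exists x, f x = y.

Definition projective (Q : lmodType R) :=
  forall (M N : lmodType R) (g : {linear M -> N}) (f : {linear Q -> N}),
    surj g -> exists h : {linear Q -> M}, forall x, g (h x) = f x.

Definition exact_at (L M N : lmodType R)
    (f : {linear L -> M}) (g : {linear M -> N}) :=
  forall y, g y = 0 <-> exists x, f x = y.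

Definition projective_resolution (Q : nat -> lmodType R)
    (d : forall n, {linear Q n.+1 -> Q n})
    (M : lmodType R) (eps : {linear Q 0 -> M}) :=
  [/\ forall n, projective (Q n),
      forall n, exact_at (d n.+1) (d n),
      exact_at (d 0) eps
    & surj eps].

End HomologicalAlgebra.

(* The monoid structures of the library [monalg] exclude nontrivial units and
   its rings are nontrivial, so only its type of finitely supported functions
   and their addition are used here. *)

Section LinearExtension.
Variables (I : choiceType) (G V : zmodType) (f : I -> {additive G -> V}).

Definition malg_ext (x : {malg G[I]}) : V := \sum_(i <- msupp x) f i x@_i.

Lemma malg_extw (d : {fset I}) x :
  (msupp x `<=` d)%fset -> malg_ext x = \sum_(i <- d) f i x@_i.
Proof.
move=> le; apply: (big_fset_incl _ le) => i _ /mcoeff_outdom ->.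
by rewrite raddf0.
Qed.

Fact malg_ext_is_additive : additive malg_ext.
Proof.
move=> x y; pose d := (msupp x `|` msupp y)%fset.
rewrite (@malg_extw d (x - y)) ?msuppB_le //.
rewrite (@malg_extw d x) ?fsubsetUl // (@malg_extw d y) ?fsubsetUr //.
by rewrite -sumrB; apply: eq_bigr => i _; rewrite mcoeffB raddfB.
Qed.

Lemma malg_extU i c : malg_ext << c *g i >> = f i c.
Proof.
by rewrite (malg_extw (msuppU_le (k:=i) (x:=c))) big_seq_fset1 mcoeffUU.
Qed.

End LinearExtension.

Section BilinearExtension.
Variables (K : comPzRingType) (I X Y : choiceType) (op : I -> X -> Y).
Implicit Types (x : {malg K[I]}) (u : {malg K[X]}).

Definition malg_bilin x u : {malg K[Y]} :=
  \sum_(s <- msupp x) \sum_(e <- msupp u) << x@_s * u@_e *g op s e >>.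

Lemma malg_bilinw (d1 : {fset I}) (d2 : {fset X}) x u :
  (msupp x `<=` d1)%fset -> (msupp u `<=` d2)%fset ->
  malg_bilin x u = \sum_(s <- d1) \sum_(e <- d2) << x@_s * u@_e *g op s e >>.
Proof.
move=> le1 le2; rewrite /malg_bilin (big_fset_incl _ le1) /=; last first.
  by move=> s _ /mcoeff_outdom xs; rewrite big1 // => e _;
     rewrite xs mul0r monalgU0.
apply: eq_bigr => s _; apply: big_fset_incl => // e _ /mcoeff_outdom ->.
by rewrite mulr0 monalgU0.
Qed.

Fact malg_bilinBl u : additive (malg_bilin^~ u).
Proof.
move=> x y; pose d := (msupp x `|` msupp y)%fset.
rewrite !(@malg_bilinw d (msupp u)) ?msuppB_le ?fsubsetUl ?fsubsetUr //.
rewrite -sumrB; apply: eq_bigr => s _; rewrite -sumrB; apply: eq_bigr => e _.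
by rewrite mcoeffB mulrBl monalgUB.
Qed.

Fact malg_bilinBr x : additive (malg_bilin x).
Proof.
move=> u v; pose d := (msupp u `|` msupp v)%fset.
rewrite !(@malg_bilinw (msupp x) d) ?msuppB_le ?fsubsetUl ?fsubsetUr //.
rewrite -sumrB; apply: eq_bigr => s _; rewrite -sumrB; apply: eq_bigr => e _.
by rewrite mcoeffB mulrBr monalgUB.
Qed.

HB.instance Definition _ x :=
  GRing.isAdditive.Build {malg K[X]} {malg K[Y]} (malg_bilin x)
    (malg_bilinBr x).

Lemma malg_bilinUU s e (a b : K) :
  malg_bilin << a *g s >> << b *g e >> = << a * b *g op s e >>.
Proof.
by rewrite (malg_bilinw msuppU_le msuppU_le) !big_seq_fset1 !mcoeffUU.
Qed.

Definition malg_bilinr u := malg_bilin^~ u.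

HB.instance Definition _ u :=
  GRing.isAdditive.Build {malg K[I]} {malg K[Y]} (malg_bilinr u)
    (malg_bilinBl u).

End BilinearExtension.

Section AdditiveExtensionality.
Variables (I : choiceType) (G V : zmodType).

Lemma malg_eq_additive (f g : {additive {malg G[I]} -> V}) :
  (forall c i, f << c *g i >> = g << c *g i >>) -> f =1 g.
Proof.
by move=> fg x; rewrite [x]monalgE !raddf_sum; apply: eq_bigr => i _.
Qed.

End AdditiveExtensionality.

Section Associativity.
Variables (K : comPzRingType) (I J X L Y Z : choiceType).
Variables (opIJ : I -> J -> L) (opL : L -> X -> Z).
Variables (opJ : J -> X -> Y) (opI : I -> Y -> Z).
Hypothesis opA : forall i j x, opI i (opJ j x) = opL (opIJ i j) x.

Lemma malg_bilinA (x : {malg K[I]}) (y : {malg K[J]}) (u : {malg K[X]}) :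
  malg_bilin opI x (malg_bilin opJ y u) =
  malg_bilin opL (malg_bilin opIJ x y) u.
Proof.
rewrite -[LHS]/(malg_bilinr opI (malg_bilin opJ y u) x).
rewrite -[RHS]/((malg_bilinr opL u \o malg_bilinr opIJ y) x).
move: x; apply: malg_eq_additive => a i /=; rewrite /malg_bilinr.
rewrite -[LHS]/((malg_bilin opI << a *g i >> \o malg_bilinr opJ u) y).
rewrite -[RHS]/((malg_bilinr opL u \o malg_bilin opIJ << a *g i >>) y).
move: y; apply: malg_eq_additive => b j /=; rewrite /malg_bilinr.
rewrite -[LHS]/((malg_bilin opI << a *g i >> \o malg_bilin opJ << b *g j >>) u).
move: u; rewrite malg_bilinUU; apply: malg_eq_additive => c k /=.
by rewrite !malg_bilinUU opA mulrA.
Qed.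

End Associativity.

(* The semigroup algebra of [M] over [K], as a ring. *)
Definition salg (K : comPzRingType) (M : monoidType) : Type := {malg K[M]}.

Section SemigroupAlgebra.
Variables (K : comPzRingType) (M : monoidType).

HB.instance Definition _ := GRing.Zmodule.on (salg K M).

Definition salg_one : salg K M := << 1 *g 1%g >>.
Definition salg_mul : salg K M -> salg K M -> salg K M :=
  malg_bilin (fun s t : M => (s * t)%g).

Fact salg_mulA : associative salg_mul.
Proof. by move=> x y z; apply: malg_bilinA => s t u; rewrite mulgA. Qed.

Fact salg_mul1 : left_id salg_one salg_mul.
Proof.
apply: (malg_eq_additive (f := malg_bilin _ _) (g := idfun)) => c s /=.
by rewrite malg_bilinUU mul1r mul1g.
Qed.

Fact salg_mulr1 : right_id salg_one salg_mul.
Proof.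
apply: (malg_eq_additive (f := malg_bilinr _ _) (g := idfun)) => c s /=.
by rewrite /malg_bilinr malg_bilinUU mulr1 mulg1.
Qed.

Fact salg_mulDl : left_distributive salg_mul +%R.
Proof. by move=> x y z; apply: (raddfD (malg_bilinr _ z)). Qed.

Fact salg_mulDr : right_distributive salg_mul +%R.
Proof. by move=> x y z; apply: raddfD. Qed.

HB.instance Definition _ := GRing.Zmodule_isPzRing.Build (salg K M)
  salg_mulA salg_mul1 salg_mulr1 salg_mulDl salg_mulDr.

Definition salg_of (s : M) : salg K M := << 1 *g s >>.

Lemma salg_of1 : salg_of 1%g = 1. Proof. by []. Qed.

Lemma salg_ofM s t : salg_of (s * t)%g = salg_of s * salg_of t.
Proof.
by rewrite [RHS]malg_bilinUU mulr1.
Qed.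

End SemigroupAlgebra.

Arguments salg_of K {M} s.

(* [K E(S)] as a left [K S]-module; not the regular module. *)
Definition idem_alg (K : comPzRingType) (S : inverseMonoidType) : Type :=
  salg K (idem S).

Section IdempotentModule.
Variables (K : comPzRingType) (S : inverseMonoidType).
Local Notation KS := (salg K S).
Local Notation KE := (idem_alg K S).

HB.instance Definition _ := GRing.Zmodule.on KE.

Definition idem_scale : KS -> KE -> KE := malg_bilin (@idem_conj S).

Lemma idem_conjM (s t : S) e :
  idem_conj s (idem_conj t e) = idem_conj (s * t)%g e.
Proof. by apply: val_inj; rewrite /= invgM !mulgA. Qed.

Lemma idem_conj1 (e : idem S) : idem_conj 1%g e = e.
Proof. by apply: val_inj; rewrite /= invg1 mulg1 mul1g. Qed.

Fact idem_scaleA x y u : idem_scale x (idem_scale y u) = idem_scale (x * y) u.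
Proof. by apply: malg_bilinA => s t e; rewrite idem_conjM. Qed.

Fact idem_scale1 : left_id 1 idem_scale.
Proof.
apply: (malg_eq_additive (f := malg_bilin _ _) (g := idfun)) => c s /=.
by rewrite malg_bilinUU mul1r idem_conj1.
Qed.

Fact idem_scaleDr : right_distributive idem_scale +%R.
Proof. by move=> x u v; apply: raddfD. Qed.

Fact idem_scaleDl u : {morph idem_scale^~ u : x y / x + y}.
Proof. by move=> x y; apply: (raddfD (malg_bilinr _ u)). Qed.

HB.instance Definition _ := GRing.Zmodule_isLmodule.Build KS KE
  idem_scaleA idem_scale1 idem_scaleDr idem_scaleDl.

Lemma idem_scaleE (s : S) (e : idem S) :
  salg_of K s *: (salg_of K e : KE) = (salg_of K (idem_conj s e) : KE).
Proof. by rewrite [LHS]malg_bilinUU mulr1. Qed.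

(* [r(s)], [s \in S], extended [K]-linearly. *)
Definition aug : KS^o -> KE := malg_ext (fun s => mkmalgU (idem_rng s)).

Fact aug_is_additive : additive aug.
Proof. exact: malg_ext_is_additive. Qed.

HB.instance Definition _ := GRing.isAdditive.Build KS^o KE aug aug_is_additive.

Fact aug_is_scalable : scalable aug.
Proof.
move=> x y; rewrite -[RHS]/((malg_bilinr (@idem_conj S) (aug y)) x).
rewrite -[LHS]/((aug \o malg_bilinr (fun s t : S => (s * t)%g) y) x).
move: x; apply: malg_eq_additive => a s /=; rewrite /malg_bilinr.
rewrite -[RHS]/((malg_bilin (@idem_conj S) << a *g s >> \o aug) y).
rewrite -[LHS]/((aug \o malg_bilin (fun s t : S => (s * t)%g) << a *g s >>) y).
move: y; apply: malg_eq_additive => b t /=.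
rewrite malg_bilinUU /aug !malg_extU /= malg_bilinUU; congr (mkmalgU _ _).
by apply: val_inj; rewrite /= /rng invgM !mulgA.
Qed.

HB.instance Definition _ :=
  GRing.isScalable.Build KS KS^o KE *:%R aug aug_is_scalable.

Lemma augE (s : S) : aug (salg_of K s) = salg_of K (idem_rng s).
Proof. exact: malg_extU. Qed.

End IdempotentModule.

(* The direct sum of copies of the left module [R] indexed by [I]. *)
Definition free_sum (R : pzRingType) (I : choiceType) : Type := {malg R[I]}.

Section FreeSum.
Variables (R : pzRingType) (I : choiceType).

HB.instance Definition _ := GRing.Zmodule.on (free_sum R I).

Definition free_sum_scale (c : R) (x : free_sum R I) : free_sum R I :=
  [malg i in msupp x => c * x@_i].

Lemma free_sum_scaleE c x i : (free_sum_scale c x)@_i = c * x@_i.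
Proof. by rewrite mcoeffE; case: msuppP; rewrite ?mulr0. Qed.

Fact free_sum_scaleA c1 c2 x :
  free_sum_scale c1 (free_sum_scale c2 x) = free_sum_scale (c1 * c2) x.
Proof. by apply/malgP => i; rewrite !free_sum_scaleE mulrA. Qed.

Fact free_sum_scale1 : left_id 1 free_sum_scale.
Proof. by move=> x; apply/malgP => i; rewrite free_sum_scaleE mul1r. Qed.

Fact free_sum_scaleDr : right_distributive free_sum_scale +%R.
Proof.
by move=> c x y; apply/malgP => i; rewrite !(mcoeffD, free_sum_scaleE) mulrDr.
Qed.

Fact free_sum_scaleDl x : {morph free_sum_scale^~ x : c1 c2 / c1 + c2}.
Proof.
by move=> c1 c2; apply/malgP => i; rewrite !(mcoeffD, free_sum_scaleE) mulrDl.
Qed.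

HB.instance Definition _ := GRing.Zmodule_isLmodule.Build R (free_sum R I)
  free_sum_scaleA free_sum_scale1 free_sum_scaleDr free_sum_scaleDl.

Lemma mcoeff_scale c (x : free_sum R I) i : (c *: x)@_i = c * x@_i.
Proof. exact: free_sum_scaleE. Qed.

End FreeSum.

(* For an idempotent [e], this is the left ideal [R e], see [left_idealP]. *)
Definition left_ideal (R : pzRingType) (e : R) : pred R :=
  [pred x | x * e == x].

Lemma left_idealP (R : pzRingType) (e x : R) : e * e = e ->
  reflect (exists y, x = y * e) (x \in left_ideal e).
Proof.
move=> ee; apply: (iffP eqP) => [<-|[y ->]]; first by exists x.
by rewrite -mulrA ee.
Qed.

Section Bar.
Variables (K : comPzRingType) (S : inverseMonoidType).
Local Notation KS := (salg K S).

Definition tprod n (t : n.-tuple S) : S := (\prod_(s <- t) s)%g.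
Definition trng n (t : n.-tuple S) : KS := salg_of K (rng (tprod t)).

Lemma trng_idem n (t : n.-tuple S) : trng t * trng t = trng t.
Proof. by rewrite -salg_ofM (eqP (rng_idem _)). Qed.

Definition bar_pred n : pred (free_sum KS (n.-tuple S)) :=
  fun x => all (fun t => x@_t \in left_ideal (trng t)) (msupp x).
Arguments bar_pred n x /.

Lemma bar_predP n (x : free_sum KS (n.-tuple S)) :
  reflect (forall t, x@_t \in left_ideal (trng t)) (x \in @bar_pred n).
Proof.
apply: (iffP allP) => [xP t|xP t _]; last exact: xP.
by have [/xP //|_] := msuppP x t; rewrite inE mul0r.
Qed.

Fact bar_submod_closed n : submod_closed (@bar_pred n).
Proof.
split=> [|c x y /bar_predP xP /bar_predP yP]; apply/bar_predP => t.
  by rewrite mcoeff0 inE mul0r.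
rewrite inE mcoeffD mcoeff_scale mulrDl -mulrA.
by rewrite (eqP (xP t)) (eqP (yP t)).
Qed.

HB.instance Definition _ n :=
  GRing.isSubmodClosed.Build KS (free_sum KS (n.-tuple S)) (@bar_pred n)
    (@bar_submod_closed n).

(* The direct sum of the left ideals [KS r(s_1 ... s_n)]. *)
Record bar n :=
  Bar { bar_val : free_sum KS (n.-tuple S); _ : bar_val \in @bar_pred n }.

HB.instance Definition _ n := [isSub for @bar_val n].
HB.instance Definition _ n := [Choice of bar n by <:].
HB.instance Definition _ n := [SubChoice_isSubLmodule of bar n by <:].

Fact bar_cell_subproof n (a : S) (t : n.-tuple S) :
  (<< salg_of K a * trng t *g t >> : free_sum _ _) \in @bar_pred n.
Proof.
apply/bar_predP => u; rewrite inE mcoeffU; case: (t =P u) => [<-|_].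
  by rewrite mulr1n -mulrA trng_idem.
by rewrite mulr0n mul0r.
Qed.

(* The element [a (s_1, ..., s_n) = a r(s_1 ... s_n) (s_1, ..., s_n)]. *)
Definition bar_cell n (a : S) (t : n.-tuple S) : bar n :=
  Bar (bar_cell_subproof a t).

(* The extension [\sum_t x_t (t) |-> \sum_t x_t g(t)]. *)
Definition bar_ext n (V : lmodType KS) (g : n.-tuple S -> V) (x : bar n) : V :=
  \sum_(t <- msupp (val x)) (val x)@_t *: g t.

Section BarExt.
Variables (n : nat) (V : lmodType KS) (g : n.-tuple S -> V).

Lemma bar_extw (d : {fset n.-tuple S}) (x : bar n) :
  (msupp (val x) `<=` d)%fset -> bar_ext g x = \sum_(t <- d) (val x)@_t *: g t.
Proof.
move=> le; apply: (big_fset_incl _ le) => t _ /mcoeff_outdom ->.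
by rewrite scale0r.
Qed.

Fact bar_ext_is_linear : linear (bar_ext g).
Proof.
move=> c x y.
pose d := (msupp (val (c *: x + y)%R) `|` (msupp (val x) `|` msupp (val y)))%fset.
rewrite (@bar_extw d) ?fsubsetUl // (@bar_extw d x); last first.
  by rewrite /d fsetUCA fsubsetUl.
rewrite (@bar_extw d y) /=; last by rewrite /d fsetUA fsubsetUr.
rewrite scaler_sumr -big_split; apply: eq_bigr => t _ /=.
by rewrite mcoeffD mcoeff_scale scalerDl scalerA.
Qed.

HB.instance Definition _ :=
  GRing.isLinear.Build KS (bar n) V *:%R (bar_ext g) bar_ext_is_linear.

Lemma bar_ext_cell (a : S) (t : n.-tuple S) :
  idem_le (dom a) (rng (tprod t)) -> bar_ext g (bar_cell a t) = salg_of K a *: g t.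
Proof.
move=> /eqP le; rewrite (@bar_extw [fset t]%fset) ?msuppU_le //=.
rewrite big_seq_fset1 mcoeffUU /trng -salg_ofM; congr (salg_of K _ *: _).
have domE : a = (a * dom a)%g by rewrite /dom mulgA mulgVg.
by rewrite {1}domE -mulgA -le -domE.
Qed.

End BarExt.

(* [P_0 = KS], with generator [1], and
   [P_n = \bigoplus_(s_1, ..., s_n) KS r(s_1 ... s_n)] for [n > 0]. *)
Definition bar_mod (n : nat) : lmodType KS :=
  if n is m.+1 then bar m.+1 else KS^o.

(* [(s_2, ..., s_n)], [(s_1, ..., s_{n-1})], and
   [(s_1, ..., s_i s_{i+1}, ..., s_n)] with [i] counted from 0. *)
Definition tuple_tail n (t : n.+1.-tuple S) : n.-tuple S :=
  [tuple tnth t (lift ord0 j) | j < n].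
Definition tuple_front n (t : n.+1.-tuple S) : n.-tuple S :=
  [tuple tnth t (lift ord_max j) | j < n].
Definition tuple_merge n (i : 'I_n) (t : n.+1.-tuple S) : n.-tuple S :=
  [tuple if (j < i)%N then tnth t (widen_ord (leqnSn n) j)
         else if j == i
         then (tnth t (widen_ord (leqnSn n) j) * tnth t (lift ord0 j))%g
         else tnth t (lift ord0 j) | j < n].

Definition bar_diff_gen n (t : n.+2.-tuple S) : bar n.+1 :=
  bar_cell (thead t) (tuple_tail t)
  + \sum_(i < n.+1) (-1) ^+ i.+1 *: bar_cell 1%g (tuple_merge i t)
  + (-1) ^+ n.+2 *: bar_cell 1%g (tuple_front t).

Definition bar_diff1_gen (t : 1.-tuple S) : KS^o := salg_of K (thead t) - 1.

(* [bar_diff n] is the map [\partial_{n+1} : P_{n+1} -> P_n]. *)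
Definition bar_diff (n : nat) : {linear bar_mod n.+1 -> bar_mod n} :=
  match n return {linear bar_mod n.+1 -> bar_mod n} with
  | 0 => bar_ext bar_diff1_gen
  | m.+1 => bar_ext (@bar_diff_gen m)
  end.

Lemma bar_diff0E (a : S) (t : 1.-tuple S) :
  idem_le (dom a) (rng (tprod t)) ->
  bar_diff 0 (bar_cell a t) = salg_of K a * (salg_of K (thead t) - 1).
Proof. exact: bar_ext_cell. Qed.

Lemma bar_diffSE n (a : S) (t : n.+2.-tuple S) :
  idem_le (dom a) (rng (tprod t)) ->
  bar_diff n.+1 (bar_cell a t) = salg_of K a *: bar_diff_gen t.
Proof. exact: bar_ext_cell. Qed.

End Bar.

(* Main.v *)
(* Inside the free modules on the n-tuples, the P_n form a subcomplex of the
   standard complex B of the monoid S.  On B the additive maps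
   h_w : a(s_1, ..., s_n) |-> w(a) (a, s_1, ..., s_n), for a function w on S,
   satisfy D h_w + h_w D = (left multiplication by w(a)) as soon as
   w(a s_1) = w(a).
   - For constant w = b, this gives D h_b = b - h_b D, whence D D h_b = h_b D D;
     the images of the h_b generate B, so D D = 0 by induction on the degree.
   - For w = r, the condition holds on the basis elements of P_n, where
     d(a) <= r(s_1 ... s_n); moreover r(a) a = a, and h_r preserves P, so h_r is
     a contracting homotopy of P.  In degree 0, D h_r = 1 - r, and r is the
     augmentation followed by the inclusion of KE(S) into KS.
   Projectivity is that of direct sums of left ideals generated by
   idempotents. *)
Require Import Defs.
From HB Require Import structures.
From mathcomp Require Import all_boot ssralg finmap.
From mathcomp.multinomials Require Import monalg.

Set Implicit Arguments.
Unset Strict Implicit.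
Unset Printing Implicit Defensive.

Import GRing.Theory.
Local Open Scope ring_scope.

HB.instance Definition _ (I : choiceType) (G V : zmodType)
    (f : I -> {additive G -> V}) :=
  GRing.isAdditive.Build {malg G[I]} V (malg_ext f) (malg_ext_is_additive f).

Lemma monalgU_inj (G : zmodType) (I : choiceType) (i : I) :
  injective (fun x : G => << x *g i >>).
Proof. by move=> x y /(congr1 (mcoeff i)); rewrite !mcoeffUU. Qed.

Lemma free_sum_scaleU (R : pzRingType) (I : choiceType) (x y : R) (i : I) :
  x *: (<< y *g i >> : free_sum R I) = << x * y *g i >>.
Proof.
by apply/malgP => j; rewrite mcoeff_scale !mcoeffU; case: eqP; rewrite ?mulr0.
Qed.

(** * Alternating sums of faces *)

Section AlternatingSum.
Variables (R : pzRingType) (V : lmodType R).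

Definition alternating n (x : V) (y : 'I_n -> V) (z : V) :=
  x + \sum_(i < n) (-1) ^+ i.+1 *: y i + (-1) ^+ n.+1 *: z.

Lemma eq_alternating n x1 x2 (y1 y2 : 'I_n -> V) z1 z2 :
  x1 = x2 -> y1 =1 y2 -> z1 = z2 -> alternating x1 y1 z1 = alternating x2 y2 z2.
Proof.
by move=> -> y12 ->; congr (_ + _ + _); apply: eq_bigr => i _; rewrite y12.
Qed.

Lemma scaler_alternating (c : R) n (x z : V) (y : 'I_n -> V) :
  c *: alternating x y z = alternating (c *: x) (fun i => c *: y i) (c *: z).
Proof.
have sign j v : c *: ((-1) ^+ j *: v) = (-1) ^+ j *: (c *: v) :> V.
  by rewrite !scalerA commr_sign.
rewrite !scalerDr scaler_sumr sign; congr (_ + _ + _).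
by apply: eq_bigr => i _; rewrite sign.
Qed.

Lemma alternating0 (x z : V) (y : 'I_0 -> V) : alternating x y z = x - z.
Proof. by rewrite /alternating big_ord0 addr0 scaleN1r. Qed.

(* The first inner face of [(a, s_1, ...)] is the [(a s_1, s_2, ...)] of the
   differential of [a(s_1, ...)]; the other faces come with opposite signs. *)
Lemma alternating_cancel n (x z : V) (y : 'I_n.+1 -> V) :
  alternating x y z + alternating (y ord0) (fun i => y (lift ord0 i)) z = x.
Proof.
rewrite /alternating big_ord_recl expr1 scaleN1r.
under eq_bigr => i _ do rewrite lift0 exprS mulN1r scaleNr.
rewrite sumrN [(-1) ^+ n.+2]exprS mulN1r scaleNr.
by rewrite -opprD -(addrA x) -opprD subrK.
Qed.

End AlternatingSum.

Lemma raddf_alternating (R : pzRingType) (V W : lmodType R)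
    (f : {additive V -> W}) n (x z : V) (y : 'I_n -> V) :
  f (alternating x y z) = alternating (f x) (fun i => f (y i)) (f z).
Proof.
rewrite !raddfD raddf_sum raddfZsign; congr (_ + _ + _).
by apply: eq_bigr => i _; rewrite raddfZsign.
Qed.

Lemma projective_regular (R : pzRingType) : projective R^o.
Proof.
move=> M N g f g_surj; have [m gm] := g_surj (f 1).
have lin : linear (fun x : R^o => x *: m).
  by move=> c x y; rewrite scalerDl scalerA.
pose h : {linear R^o -> M} :=
  HB.pack (fun x : R^o => x *: m) (GRing.isLinear.Build R R^o M *:%R _ lin).
by exists h => x; rewrite linearZ gm -linearZ; congr (f _); apply: mulr1.
Qed.

(* The element [c a (s_1, ..., s_n)] of the free module, without the factor
   [r(s_1 ... s_n)] of [bar_cell]. *)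
HB.lock Definition cell (K : comPzRingType) (S : inverseMonoidType) n
    (c : K) (a : S) (t : n.-tuple S) : free_sum (salg K S) (n.-tuple S) :=
  << (<< c *g a >> : salg K S) *g t >>.

(** Homotopies, left translations, the collapse and the projection onto P are instances; each keeps
    the coefficient [c] in K. *)
HB.lock Definition cell_map (K : comPzRingType) (S : inverseMonoidType) n m
    (w : n.-tuple S -> S -> S) (u : n.-tuple S -> S -> m.-tuple S) :
    free_sum (salg K S) (n.-tuple S) -> free_sum (salg K S) (m.-tuple S) :=
  malg_ext (fun t => malg_ext (fun a => mkmalgU (u t a) \o mkmalgU (w t a))).

HB.lock Definition free_ext (R : pzRingType) (I : choiceType) (V : lmodType R)
    (g : I -> V) (y : free_sum R I) : V :=
  \sum_(t <- msupp y) y@_t *: g t.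

Section FreeExt.
Variables (R : pzRingType) (I : choiceType) (V : lmodType R) (g : I -> V).
Implicit Type y : free_sum R I.

Lemma free_extE y : free_ext g y = \sum_(t <- msupp y) y@_t *: g t.
Proof. by rewrite [free_ext]unlock. Qed.

Lemma free_extw (d : {fset I}) y :
  (msupp y `<=` d)%fset -> free_ext g y = \sum_(t <- d) y@_t *: g t.
Proof.
move=> le; rewrite free_extE; apply: (big_fset_incl _ le) => t _ /mcoeff_outdom ->.
by rewrite scale0r.
Qed.

Fact free_ext_is_zmod_morphism : zmod_morphism (free_ext g).
Proof.
move=> x y; pose d := (msupp x `|` msupp y)%fset.
rewrite !(@free_extw d) ?fsubsetUl ?fsubsetUr ?msuppB_le // -sumrB.
by apply: eq_bigr => t _; rewrite mcoeffB scalerBl.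
Qed.

HB.instance Definition _ :=
  GRing.isZmodMorphism.Build (free_sum R I) V (free_ext g) free_ext_is_zmod_morphism.

Lemma free_extU (x : R) t : free_ext g << x *g t >> = x *: g t.
Proof. by rewrite (free_extw msuppU_le) big_seq_fset1 mcoeffUU. Qed.

End FreeExt.

(** * The standard complex B *)

Section StandardComplex.
Variables (K : comPzRingType) (S : inverseMonoidType).
Local Notation KS := (salg K S).
Local Notation "'B_ n" := (free_sum KS (n.-tuple S)) (at level 8, n at level 2).
Implicit Types (a b p q s : S) (c : K).

Fact cell_map_is_zmod_morphism n m w u : zmod_morphism (@cell_map K S n m w u).
Proof. by rewrite unlock; apply: raddfB. Qed.

HB.instance Definition _ n m w u :=
  GRing.isZmodMorphism.Build 'B_n 'B_m (@cell_map K S n m w u)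
    (cell_map_is_zmod_morphism w u).

Lemma cell_mapE n m w u c a t :
  @cell_map K S n m w u (cell c a t) = cell c (w t a) (u t a).
Proof. by rewrite !unlock malg_extU /= malg_extU. Qed.

Lemma mcoeff_cell n c a (t u : n.-tuple S) :
  (cell c a t)@_u = (<< c *g a >> : KS) *+ (t == u).
Proof. by rewrite unlock; apply: mcoeffU. Qed.

Lemma eq_cell n (V : zmodType) (f g : {additive 'B_n -> V}) :
  (forall c a t, f (cell c a t) = g (cell c a t)) -> f =1 g.
Proof.
move=> fg; apply: malg_eq_additive => x t.
pose f' : {additive KS -> V} := f \o mkmalgU t.
pose g' : {additive KS -> V} := g \o mkmalgU t.
rewrite -[LHS]/(f' x) -[RHS]/(g' x); move: x.
by apply: malg_eq_additive => c a; have := fg c a t; rewrite unlock.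
Qed.

Definition std_gen n (t : n.+1.-tuple S) : 'B_n :=
  alternating (cell 1 (thead t) (tuple_tail t))
    (fun i => cell 1 1%g (tuple_merge i t)) (cell 1 1%g (tuple_front t)).

Definition std_diff n : 'B_n.+1 -> 'B_n := free_ext (@std_gen n).

HB.instance Definition _ n := GRing.Additive.copy (@std_diff n) (free_ext _).

Lemma mul_cell n c a b (t : n.-tuple S) :
  (<< c *g a >> : KS) *: cell 1 b t = cell c (a * b)%g t.
Proof.
rewrite unlock free_sum_scaleU; congr (<< _ *g _ >>).
by rewrite -[c in RHS]mulr1; apply: malg_bilinUU.
Qed.

Lemma std_diff_cell n c a t :
  @std_diff n (cell c a t) =
    alternating (cell c (a * thead t)%g (tuple_tail t))
      (fun i => cell c a (tuple_merge i t)) (cell c a (tuple_front t)).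
Proof.
rewrite /std_diff {1}[cell]unlock free_extU scaler_alternating.
by apply: eq_alternating => [|i|]; rewrite mul_cell ?mulg1.
Qed.

(** * The homotopies h_w *)

Definition std_htpy n (w : S -> S) : 'B_n -> 'B_n.+1 :=
  cell_map (fun=> w) (fun t a => [tuple of a :: t]).

HB.instance Definition _ n w := GRing.Additive.copy (@std_htpy n w) (cell_map _ _).

Lemma std_htpyE n w c a (t : n.-tuple S) :
  std_htpy w (cell c a t) = cell c (w a) [tuple of a :: t].
Proof. exact: cell_mapE. Qed.

Lemma thead_cons n a (t : n.-tuple S) : thead [tuple of a :: t] = a.
Proof. by rewrite theadE. Qed.

Lemma tuple_tail_cons n a (t : n.-tuple S) :
  tuple_tail [tuple of a :: t] = t.
Proof.
by apply/eq_from_tnth => j; rewrite tnth_mktuple (tnth_nth a) /= -tnth_nth.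
Qed.

Lemma tuple_front_cons n a (t : n.+1.-tuple S) :
  tuple_front [tuple of a :: t] = [tuple of a :: tuple_front t].
Proof.
apply/eq_from_tnth => j; rewrite tnth_mktuple.
case: (unliftP ord0 j) => [k|] ->; rewrite ?tnthS ?tnth0 ?tnth_mktuple.
  by rewrite !(tnth_nth a) !lift_max.
by rewrite (tnth_nth a).
Qed.

Lemma tuple_merge_cons0 n a (t : n.+1.-tuple S) :
  tuple_merge ord0 [tuple of a :: t] = [tuple of (a * thead t)%g :: tuple_tail t].
Proof.
apply/eq_from_tnth => j; rewrite tnth_mktuple.
by case: (unliftP ord0 j) => [k|] -> /=; rewrite ?tnthS ?tnth0 ?tnth_mktuple.
Qed.

Lemma tuple_merge_consS n (i : 'I_n) a (t : n.+1.-tuple S) :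
  tuple_merge (lift ord0 i) [tuple of a :: t] = [tuple of a :: tuple_merge i t].
Proof.
apply/eq_from_tnth => j; rewrite tnth_mktuple.
case: (unliftP ord0 j) => [k|] ->; rewrite ?tnthS ?tnth0 ?tnth_mktuple //.
rewrite !(tnth_nth a) /= /bump /= !add1n ltnS.
by rewrite (inj_eq (lift_inj (h := ord0))).
Qed.

(* The hypothesis on [w] serves the face [(a s_1, s_2, ...)], the only one that
   changes the coefficient. *)
Lemma std_diff_htpy n (w : S -> S) c a (t : n.+1.-tuple S) :
    w (a * thead t)%g = w a ->
  std_diff (std_htpy w (cell c a t)) + std_htpy w (std_diff (cell c a t)) =
  cell c (w a * a)%g t.
Proof.
move=> wa; rewrite std_htpyE !std_diff_cell thead_cons tuple_tail_cons.
rewrite tuple_front_cons [std_htpy w _]raddf_alternating /= !std_htpyE wa.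
set y := fun i : 'I_n.+1 => _.
rewrite -[RHS](alternating_cancel _ (cell c (w a) [tuple of a :: tuple_front t]) y).
apply: f_equal2; apply: eq_alternating => // [|i].
  by rewrite /y tuple_merge_cons0.
by rewrite /y tuple_merge_consS std_htpyE.
Qed.

(** In degree 0 there is no term h_w D; the last face of [w(a)(a)] takes its place. *)
Lemma std_diff_htpy0 (w : S -> S) c a (t : 0.-tuple S) :
  std_diff (std_htpy w (cell c a t)) + cell c (w a) t = cell c (w a * a)%g t.
Proof.
rewrite std_htpyE std_diff_cell thead_cons alternating0.
by rewrite !(tuple0 (tuple_tail _), tuple0 (tuple_front _), tuple0 t) subrK.
Qed.

(** * Vanishing of D D *)

Definition mull n s : 'B_n -> 'B_n := cell_map (fun _ a => (s * a)%g) (fun t _ => t).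
HB.instance Definition _ n s := GRing.Additive.copy (@mull n s) (cell_map _ _).

Lemma mullE n s c a t : @mull n s (cell c a t) = cell c (s * a)%g t.
Proof. exact: cell_mapE. Qed.

Lemma std_diff_mull n s y : @std_diff n (mull s y) = mull s (std_diff y).
Proof.
rewrite -[LHS]/((@std_diff n \o mull s) y) -[RHS]/((mull s \o @std_diff n) y).
move: y; apply: eq_cell => c a t.
rewrite [LHS]/= mullE std_diff_cell [RHS]/= std_diff_cell.
rewrite [RHS]raddf_alternating /=.
by apply: eq_alternating => [|i|]; rewrite mullE ?mulgA.
Qed.

Lemma std_diff_contract n s (y : 'B_n.+1) :
  std_diff (std_htpy (fun=> s) y) = mull s y - std_htpy (fun=> s) (std_diff y).
Proof.
apply: (addIr (std_htpy (fun=> s) (std_diff y))); rewrite subrK.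
rewrite -[LHS]/(((@std_diff n.+1 \o std_htpy (fun=> s)) \+
                 (std_htpy (fun=> s) \o @std_diff n)) y).
move: y; apply: eq_cell => c a t /=.
by rewrite mullE -(std_diff_htpy (w := fun=> s)).
Qed.

(** Reduces claims about B in positive degree to images of the homotopies of constant weight. *)
Lemma cell_htpy n c a (t : n.+1.-tuple S) :
  cell c a t = std_htpy (fun=> a) (cell c (thead t) (tuple_tail t)).
Proof.
rewrite std_htpyE; congr cell; apply/eq_from_tnth => j.
by case: (unliftP ord0 j) => [k|] ->; rewrite ?tnthS ?tnth_mktuple.
Qed.

(** In degree 0 this is the augmentation of KS into K followed by c |-> c s. *)
Definition collapse n s : 'B_n -> 'B_n := cell_map (fun _ _ => s) (fun t _ => t).
HB.instance Definition _ n s := GRing.Additive.copy (@collapse n s) (cell_map _ _).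

Lemma collapseE n s c a t : @collapse n s (cell c a t) = cell c s t.
Proof. exact: cell_mapE. Qed.

Lemma std_diff_contract0 s (y : 'B_0) :
  std_diff (std_htpy (fun=> s) y) = mull s y - collapse s y.
Proof.
apply: (addIr (collapse s y)); rewrite subrK.
rewrite -[LHS]/(((@std_diff 0 \o std_htpy (fun=> s)) \+ collapse s) y).
move: y; apply: eq_cell => c a t.
by rewrite [LHS]/= [RHS]/= collapseE mullE (std_diff_htpy0 (fun=> s)).
Qed.

(** The two faces of [a(p)] have opposite signs and collapse to the same element. *)
Lemma collapse_std_diff s (y : 'B_1) : collapse s (std_diff y) = 0.
Proof.
rewrite -[LHS]/((collapse s \o @std_diff 0) y) -[RHS]/((\0 : 'B_1 -> 'B_0) y).
move: y; apply: eq_cell => c a t; rewrite [LHS]/= [RHS]/= std_diff_cell.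
rewrite !(tuple0 (tuple_tail _), tuple0 (tuple_front _)) alternating0.
by rewrite [LHS](raddfB (collapse s)) [LHS]/= !collapseE subrr.
Qed.

Lemma std_diff_diff n (y : 'B_n.+2) : std_diff (std_diff y) = 0.
Proof.
have diffB m (u v : 'B_m.+1) : std_diff (u - v) = std_diff u - std_diff v.
  exact: raddfB.
rewrite -[LHS]/((@std_diff n \o @std_diff n.+1) y).
rewrite -[RHS]/((\0 : 'B_n.+2 -> 'B_n) y).
elim: n y => [|n IHn]; apply: eq_cell => c a t; rewrite [LHS]/= [RHS]/= cell_htpy.
  (* Base case: D D h_a y reduces to the collapse of D y, which is 0. *)
  rewrite std_diff_contract diffB std_diff_contract0 std_diff_mull.
  by rewrite collapse_std_diff subr0 subrr.
(* D D h_a y = a D y - (a D y - h_a D D y) = h_a D D y. *)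
have /= DD := IHn (cell c (thead t) (tuple_tail t)).
rewrite std_diff_contract diffB std_diff_contract std_diff_mull DD.
by rewrite [std_htpy _ 0]raddf0 subr0 subrr.
Qed.

(** * Ranges of products *)

(** The hypothesis encodes d(a) <= r(p), and r(a p) = a r(p) a^-1. This yields the condition on the
    weight w = r. *)
Lemma rng_mul a p : a = (a * rng p)%g -> rng (a * p)%g = rng a.
Proof.
move=> ap; rewrite /rng invgM !mulgA -(mulgA a p).
by rewrite -[(p * p^-1)%g]/(rng p) -ap.
Qed.

Lemma mul_rngK a p : (a * rng p * rng p = a * rng p)%g.
Proof. by rewrite -(mulgA a) (eqP (rng_idem p)). Qed.

(** Commuting the idempotents brings r(p) in front of p, which absorbs it; this is r(p q) <=
    r(p). *)
Lemma rngM_rng p q : (rng (p * q) * rng p = rng (p * q))%g.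
Proof.
by rewrite (idemC (rng_idem _) (rng_idem _)) /rng invgM !mulgA mulgVg.
Qed.

(** Since r(s p) s = s r(p) d(s) and idempotents commute, r(p) moves to the right end. Hence r(s_1
    ... s_n) times the first face s_1(s_2, ..., s_n) lies in P. *)
Lemma rngM_mul s p : (rng (s * p) * s * rng p = rng (s * p) * s)%g.
Proof.
have -> : (rng (s * p) * s = s * (rng p * dom s))%g.
  by rewrite /rng /dom invgM !mulgA.
rewrite (idemC (rng_idem _) (dom_idem _)) -(mulgA s) -(mulgA (dom s)).
by rewrite (eqP (rng_idem p)).
Qed.

Lemma tprod_cons n a (t : n.-tuple S) :
  tprod [tuple of a :: t] = (a * tprod t)%g.
Proof. exact: big_cons. Qed.

Lemma tprod_tail n (t : n.+1.-tuple S) :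
  tprod t = (thead t * tprod (tuple_tail t))%g.
Proof. by case/tupleP: t => a t; rewrite tprod_cons thead_cons tuple_tail_cons. Qed.

Lemma tprod_merge n (i : 'I_n) (t : n.+1.-tuple S) :
  tprod (tuple_merge i t) = tprod t.
Proof.
elim: n i t => [|n IHn] i; first by case: i.
case/tupleP=> a t; case: (unliftP ord0 i) => [j|] ->.
  by rewrite tuple_merge_consS !tprod_cons IHn.
by rewrite tuple_merge_cons0 !tprod_cons (tprod_tail t) mulgA.
Qed.

(** The factor [s] is the last entry; its existence is enough to apply [rngM_rng] to the last
    face. *)
Lemma tprod_front n (t : n.+1.-tuple S) :
  exists s, tprod t = (tprod (tuple_front t) * s)%g.
Proof.
elim: n t => [|n IHn] t.
  by exists (tprod t); rewrite /tprod [X in (X * _)%g]big_tuple big_ord0 mul1g.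
case/tupleP: t => a t; have [s ts] := IHn t.
by exists s; rewrite tuple_front_cons !tprod_cons ts mulgA.
Qed.

(** * The subcomplex P and its contracting homotopy *)

Definition proj n : 'B_n -> 'B_n :=
  cell_map (fun t a => a * rng (tprod t))%g (fun t _ => t).
HB.instance Definition _ n := GRing.Additive.copy (@proj n) (cell_map _ _).

Lemma projE n c a t : @proj n (cell c a t) = cell c (a * rng (tprod t))%g t.
Proof. exact: cell_mapE. Qed.

Lemma mcoeff_proj n (y : 'B_n) t : (proj y)@_t = y@_t * trng K t.
Proof.
pose rmul := malg_bilinr (fun a b : S => a * b)%g (trng K t).
rewrite -[LHS]/((mcoeff t \o @proj n) y) -[RHS]/((rmul \o mcoeff t) y).
move: y; apply: eq_cell => c a u; rewrite /= projE !mcoeff_cell.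
case: eqP => [->|_]; last by rewrite !mulr0n raddf0.
by rewrite !mulr1n /rmul /malg_bilinr malg_bilinUU mulr1.
Qed.

(** Lets additive identities on P be checked on projected basis elements, whose coefficients satisfy
    a = a r(s_1 ... s_n). *)
Lemma bar_pred_proj n (y : 'B_n) : (y \in @bar_pred K S n) = (proj y == y).
Proof.
apply/bar_predP/eqP => [yP|yP t]; last by rewrite inE -mcoeff_proj yP.
by apply/malgP => t; rewrite mcoeff_proj (eqP (yP t)).
Qed.

(** If a = a r(p), the product a p of the longer tuple has range r(a), which the coefficient r(a)
    absorbs. *)
Lemma proj_htpy n (y : 'B_n) :
  proj (std_htpy (@rng S) (proj y)) = std_htpy (@rng S) (proj y).
Proof.
rewrite -[LHS]/((@proj n.+1 \o (std_htpy (@rng S) \o @proj n)) y).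
rewrite -[RHS]/((std_htpy (@rng S) \o @proj n) y); move: y.
apply: eq_cell => c a t /=; rewrite projE std_htpyE projE tprod_cons.
by rewrite (rng_mul (esym (mul_rngK _ _))) (eqP (rng_idem _)).
Qed.

Lemma std_htpy_bar n (y : 'B_n) :
  y \in @bar_pred K S n -> std_htpy (@rng S) y \in @bar_pred K S n.+1.
Proof. by rewrite !bar_pred_proj => /eqP <-; rewrite proj_htpy. Qed.

Lemma bar_htpy n (y : 'B_n.+1) : y \in @bar_pred K S n.+1 ->
  std_diff (std_htpy (@rng S) y) + std_htpy (@rng S) (std_diff y) = y.
Proof.
rewrite bar_pred_proj => /eqP <-.
rewrite -[LHS]/((((@std_diff n.+1 \o std_htpy (@rng S)) \+
                 (std_htpy (@rng S) \o @std_diff n)) \o @proj n.+1) y).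
move: y; apply: eq_cell => c a t /=.
rewrite projE std_diff_htpy ?mul_rng // rng_mul //.
(* The condition on w = r: the coefficient a r(s_1 ... s_n) is fixed by r(s_1), as r(s_1 ... s_n) <=
   r(s_1). *)
by rewrite -!(mulgA a) (tprod_tail t) rngM_rng.
Qed.

(* The generator [(t)] of [B_n] may be replaced by [r(t) (t)] on [P_n]. *)
Lemma bar_scale n (x : bar K S n) t (V : lmodType KS) (v : V) :
  (val x)@_t *: v = (val x)@_t *: (trng K t *: v).
Proof. by have /bar_predP/(_ t)/eqP {1}<- := valP x; rewrite scalerA. Qed.

(** * Agreement of the differentials of P and B *)

Lemma val_bar_ext n m (g : n.-tuple S -> bar K S m) (x : bar K S n) :
  val (bar_ext g x) = \sum_(t <- msupp (val x)) (val x)@_t *: val (g t).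
Proof.
rewrite /bar_ext [LHS](raddf_sum val).
by apply: eq_bigr => t _; apply: linearZ.
Qed.

Lemma bar_cellE n (x : KS) a (t : n.-tuple S) :
  x * salg_of K a * trng K t = x * salg_of K a ->
  x *: val (bar_cell K a t) = x *: cell 1 a t.
Proof.
by rewrite -mulrA => xt; rewrite unlock [RHS]free_sum_scaleU [LHS]free_sum_scaleU xt.
Qed.

Lemma val_bar_diff_gen n (t : n.+2.-tuple S) :
  val (bar_diff_gen K t) =
    alternating (val (bar_cell K (thead t) (tuple_tail t)))
      (fun i => val (bar_cell K 1%g (tuple_merge i t)))
      (val (bar_cell K 1%g (tuple_front t))).
Proof. exact: raddf_alternating. Qed.

(** Multiplication by r(s_1 ... s_n) absorbs the factor that [bar_cell] puts on each face: inner
    faces have the same product, and the outer ones fall under [rngM_mul] and [rngM_rng]. *)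
Lemma trng_bar_diff_gen n (t : n.+2.-tuple S) :
  trng K t *: val (bar_diff_gen K t) = trng K t *: std_gen t.
Proof.
rewrite val_bar_diff_gen [LHS]scaler_alternating [RHS]scaler_alternating.
apply: eq_alternating => [|i|]; apply: bar_cellE.
- by rewrite /trng -!salg_ofM (tprod_tail t) rngM_mul.
- by rewrite salg_of1 mulr1 /trng tprod_merge -salg_ofM (eqP (rng_idem _)).
have [s ts] := tprod_front t.
by rewrite salg_of1 mulr1 /trng -salg_ofM ts rngM_rng.
Qed.

Lemma val_bar_diff n (x : bar K S n.+2) :
  val (bar_diff K S n.+1 x) = std_diff (val x).
Proof.
rewrite [bar_diff K S n.+1 x]/(bar_ext _ x) [LHS]val_bar_ext [RHS]free_extE.
apply: eq_bigr => t _; rewrite [LHS]bar_scale [RHS]bar_scale.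
by apply: congr1; apply: trng_bar_diff_gen.
Qed.

(** * Degree 0 and the augmentation *)

Lemma std_gen0 (t : 1.-tuple S) :
  std_gen t = << (bar_diff1_gen K t : KS) *g [tuple] >>.
Proof.
rewrite /std_gen alternating0 !(tuple0 (tuple_tail _), tuple0 (tuple_front _)).
by rewrite [cell]unlock -raddfB.
Qed.

(** The map x |-> x() identifies the regular module P_0 with B_0, which lives on the empty tuple. *)
Lemma val_bar_diff0 (x : bar K S 1) :
  << (bar_diff K S 0 x : KS) *g [tuple] >> = std_diff (val x).
Proof.
rewrite [bar_diff K S 0 x]/(bar_ext _ x) /bar_ext.
rewrite [LHS](raddf_sum (mkmalgU [tuple])) /std_diff free_extE.
by apply: eq_bigr => t _; rewrite std_gen0 [RHS]free_sum_scaleU.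
Qed.

(** The inclusion of KE(S) into KS, seen as B_0. *)
Definition cell0 : idem_alg K S -> 'B_0 :=
  malg_ext (fun e => mkmalgU [tuple] \o mkmalgU (val e)).
HB.instance Definition _ := GRing.Additive.copy cell0 (malg_ext _).

Lemma bar_htpy0 (x : KS) :
  std_diff (std_htpy (@rng S) << x *g [tuple] >>) + cell0 (aug x) = << x *g [tuple] >>.
Proof.
rewrite -[LHS]/(((@std_diff 0 \o std_htpy (@rng S) \o mkmalgU [tuple]) \+
                 (cell0 \o @aug K S)) x).
move: x; apply: malg_eq_additive => c a /=.
rewrite /aug malg_extU /cell0 malg_extU /=.
have := std_diff_htpy0 (@rng S) c a [tuple]; rewrite mul_rng.
by rewrite [cell]unlock.
Qed.

Lemma aug_bar_diff (x : bar K S 1) : aug (bar_diff K S 0 x) = 0.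
Proof.
rewrite [bar_diff K S 0 x]/(bar_ext _ x) /bar_ext raddf_sum big1 // => t _.
(* Conjugation by r(s) sends both r(s) and 1 to r(s). *)
have aug_gen : trng K t *: aug (salg_of K (thead t)) = trng K t *: aug (salg_of K 1%g).
  rewrite !augE /trng !idem_scaleE; congr (salg_of K _); apply: val_inj => /=.
  rewrite (tprod_tail t) (tuple0 (tuple_tail t)) /tprod big_nil mulg1.
  by rewrite rng1 mulg1 (eqP (rng_idem _)).
by rewrite [LHS]aug_is_scalable bar_scale raddfB scalerBr aug_gen subrr scaler0.
Qed.

(** * Projectivity *)

Lemma bar_ext_cell1 n (x : bar K S n) : bar_ext (bar_cell K 1%g) x = x.
Proof.
apply: val_inj; rewrite [LHS]val_bar_ext [RHS]monalgE.
apply: eq_bigr => t _; rewrite bar_cellE.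
  by rewrite [cell]unlock free_sum_scaleU [X in << X *g _ >>]mulr1.
by rewrite salg_of1 mulr1; have /bar_predP/(_ t)/eqP := valP x.
Qed.

Lemma projective_bar n : projective (bar K S n).
Proof.
move=> M N g f g_surj.
have lift t : exists m : M, g m == f (bar_cell K 1%g t).
  by have [m gm] := g_surj (f (bar_cell K 1%g t)); exists m; rewrite gm.
(* Each generator goes to a chosen preimage of its value under f; [bar_ext_cell1] recovers x from
   the generators. *)
exists (bar_ext (fun t => xchoose (lift t))) => x.
rewrite -[x in RHS]bar_ext_cell1 /= /bar_ext !raddf_sum.
apply: eq_bigr => t _; rewrite [LHS]linearZ_LR [RHS]linearZ_LR /=.
by rewrite (eqP (xchooseP (lift t))).
Qed.

(** * Exactness *)

Lemma exact_bar n : exact_at (bar_diff K S n.+1) (bar_diff K S n).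
Proof.
move=> y; split=> [dy0|[x <-]]; last first.
  (* Degree 0 is separate, P_0 being KS itself rather than a [bar]. *)
  case: n x {y} => [|n] x.
    apply: (@monalgU_inj KS _ ([tuple] : 0.-tuple S)); rewrite [LHS]val_bar_diff0.
    by rewrite val_bar_diff std_diff_diff monalgU0.
  by apply: val_inj; rewrite !val_bar_diff std_diff_diff.
have Dy0 : std_diff (val y) = 0.
  case: n y dy0 => [|n] y dy0; first by rewrite -val_bar_diff0 dy0 monalgU0.
  by rewrite -val_bar_diff dy0.
(* From y = D h_r y + h_r D y and D y = 0, the element h_r y is a preimage. *)
exists (Bar (std_htpy_bar (valP y))); apply: val_inj.
rewrite val_bar_diff -[RHS](bar_htpy (valP y)) Dy0.
by rewrite [std_htpy _ 0]raddf0 addr0.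
Qed.

Lemma exact_bar0 : exact_at (bar_diff K S 0) (@aug K S).
Proof.
move=> x; split=> [aug0|[y <-]]; last exact: aug_bar_diff.
(* Every x() satisfies the predicate, because the empty product has range 1. *)
have xP : << (x : KS) *g [tuple] >> \in @bar_pred K S 0.
  apply/bar_predP => t; rewrite inE /trng (tuple0 t) /tprod big_nil rng1.
  by rewrite salg_of1 mulr1.
exists (Bar (std_htpy_bar xP)).
apply: (@monalgU_inj KS _ ([tuple] : 0.-tuple S)); rewrite [LHS]val_bar_diff0.
by rewrite -[RHS]bar_htpy0 aug0 [cell0 0]raddf0 addr0.
Qed.

Lemma surj_aug : surj (@aug K S).
Proof.
(* The inclusion of KE(S) into KS is a section, since r(e) = e. *)
move=> y; exists (malg_ext (fun e => mkmalgU (val e)) y : KS).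
rewrite -[LHS]/((@aug K S \o malg_ext (fun e : idem S => mkmalgU (val e))) y).
rewrite -[RHS]/(idfun y).
move: y; apply: malg_eq_additive => c e /=.
rewrite malg_extU /aug malg_extU /=; congr (<< _ *g _ >>).
by apply: val_inj; rewrite /= /rng idemV ?(idemP e) // (eqP (idemP e)).
Qed.

End StandardComplex.

Theorem proposition3p6 (K : comPzRingType) (S : inverseMonoidType) :
  @projective_resolution (salg K S)
    (bar_mod K S) (@bar_diff K S) (idem_alg K S) (@aug K S).
Proof.
split; last 1 first.
- exact: surj_aug.
- by case=> [|n]; [apply: projective_regular|apply: projective_bar].
- exact: exact_bar.
exact: exact_bar0.
Qed.
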